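(* Let $n\ge3$, $d\ge0$ and $0\le k\le d$ be integers, let $Y_k^n$ be the $(d-k+1)\times(d-k+1)$ matrix of polynomials in $u,v,t$ defined in the context, and let $$S_k^n=\frac16\sum_\sigma \sigma Y_k^n,$$ where $\sigma$ runs through the group of all permutations of the variables $u,v,t$, acting on the matrix coefficients. Then the matrix $S_k^n$ is symmetric and its coefficients are symmetric polynomials in $u,v,t$. Moreover, for every $e\in S^{n-1}$ and every finite $C\subset S^{n-1}$, $$\sum_{(c,c')\in C^2}Y_k^n(e\cdot c,\ e\cdot c',\ c\cdot c')\succeq 0,$$ and for every finite $C\subset S^{n-1}$, $$\sum_{(c,c',c'')\in C^3}S_k^n(c\cdot c',\ c\cdot c'',\ c'\cdot c'')\succeq 0 .$$
   Context: Notation. $S^{n-1}$ is the unit sphere of $\mathbb{R}^n$, $x\cdot y$ the standard inner product. $M\succeq 0$ means that the real matrix $M$ is symmetric positive semidefinite. Polynomials $P_k^m$. For $m\ge 3$, $P_k^m(t)=C_k^{m/2-1}(t)/C_k^{m/2-1}(1)$, where the Gegenbauer polynomials are given by $C_0^\lambda=1$, $C_1^\lambda(t)=2\lambda t$, $kC_k^\lambda(t)=2(k+\lambda-1)tC_{k-1}^\lambda(t)-(k+2\lambda-2)C_{k-2}^\lambda(t)$ for $k\ge2$. For $m=2$, $P_k^2=T_k$ is the Chebyshev polynomial of the first kind: $T_0=1$, $T_1(t)=t$, $T_k(t)=2tT_{k-1}(t)-T_{k-2}(t)$. Thus $P_k^m$ has degree $k$ and $P_k^m(1)=1$. Constants.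 $\omega_m=2\pi^{m/2}/\Gamma(m/2)$ is the surface area of $S^{m-1}$, and $h_k^m=\binom{m+k-1}{m-1}-\binom{m+k-3}{m-1}$ (with $\binom{a}{b}=0$ if $a<b$) is the dimension of the space of homogeneous harmonic polynomials of degree $k$ in $m$ variables. Matrices. $Y_k^n(u,v,t)$ is the matrix with entries, for $0\le i,j\le d-k$, $$(Y_k^n)_{i,j}(u,v,t)=\lambda_{i,j}\,P_i^{n+2k}(u)\,P_j^{n+2k}(v)\,Q_k^{n-1}(u,v,t),$$ where $$Q_k^{n-1}(u,v,t)=\big((1-u^2)(1-v^2)\big)^{k/2}P_k^{n-1}\Big(\frac{t-uv}{\sqrt{(1-u^2)(1-v^2)}}\Big)$$ (this is a polynomial in $u,v,t$, and is understood as such everywhere) and $$\lambda_{i,j}=\frac{\omega_n}{\omega_{n-1}}\frac{\omega_{n+2k-1}}{\omega_{n+2k}}\big(h_i^{n+2k}h_j^{n+2k}\big)^{1/2}.$$ *)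

(* Defs.v *)
From HB Require Import structures.
From mathcomp Require Import all_boot all_order all_fingroup all_algebra finmap.
From mathcomp Require Import all_classical all_reals all_analysis.
(* The notations of mpoly clash with those of analysis. *)
From mathcomp Require Import -(notations) mpoly.
From mathcomp Require Import ring lra zify.

Set Implicit Arguments.
Unset Strict Implicit.
Unset Printing Implicit Defensive.

Import Order.TTheory GRing.Theory Num.Theory.
Import numFieldNormedType.Exports.

Local Open Scope ring_scope.

Notation "{ 'mpoly' R [ n ] }" := (mpoly.mpoly n R) : type_scope.

Section Defs.
Variable R : realType.
Implicit Types (m n d k : nat) (u v t lam s : R).

Definition dotp n (x y : 'rV[R]_n) : R := \sum_(i < n) x 0 i * y 0 i.

(* Not defined through the norm on 'rV[R]_n, which is the sup norm. *)
Definition unit_sphere n : set 'rV[R]_n := [set x | dotp x x = 1]%classic.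

Definition psdmx n (M : 'M[R]_n) : Prop :=
  M^T = M /\ forall x : 'cV[R]_n, 0 <= (x^T *m M *m x) 0 0.

Fixpoint gegenbauer lam k : {poly R} :=
  match k with
  | 0 => 1
  | k1.+1 => match k1 with
    | 0 => (2 * lam) *: 'X
    | k2.+1 => k%:R^-1 *:
        ((2 * (k%:R + lam - 1)) *: ('X * gegenbauer lam k1)
         - (k%:R + 2 * lam - 2) *: gegenbauer lam k2)
    end
  end.

Fixpoint chebyshev k : {poly R} :=
  match k with
  | 0 => 1
  | k1.+1 => match k1 with
    | 0 => 'X
    | k2.+1 => 2 *: ('X * chebyshev k1) - chebyshev k2
    end
  end.

(* P_k^m; only meaningful for m >= 2. *)
Definition Ppoly m k : {poly R} :=
  if m == 2%N then chebyshev k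
  else let C := gegenbauer (m%:R / 2 - 1) k in C.[1]^-1 *: C.

Definition Gamma s : R :=
  \int[lebesgue_measure]_(x in `]0, +oo[%classic) (x `^ (s - 1) * expR (- x)).

Definition omega m : R := 2 * pi `^ (m%:R / 2) / Gamma (m%:R / 2).

(* h_k^m; the natural-number subtractions are exact for m >= 3. *)
Definition harm_dim m k : R :=
  'C(m + k - 1, m - 1)%:R - 'C(m + k - 3, m - 1)%:R.

Definition lambda n k i j : R :=
  omega n / omega (n - 1) * (omega (n + 2 * k - 1) / omega (n + 2 * k))
  * Num.sqrt (harm_dim (n + 2 * k) i * harm_dim (n + 2 * k) j).

Definition var (i : 'I_3) : {mpoly R[3]} := mpoly.mpolyX R (mpoly.mnm1 i).
Definition Xu : {mpoly R[3]} := var (inord 0).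
Definition Xv : {mpoly R[3]} := var (inord 1).
Definition Xt : {mpoly R[3]} := var (inord 2).

Definition pt3 u v t : 'I_3 -> R := tnth [tuple u; v; t].

Definition ev3 u v t (p : {mpoly R[3]}) : R := mpoly.meval (pt3 u v t) p.

(* Q_k^m as a polynomial. All monomials of P_k^m have degree of the same parity
   as k, so homogenising P_k^m by sqrt w, with w = (1-u^2)(1-v^2), only
   produces integral powers of w; see QpolyE below. *)
Definition Qpoly m k : {mpoly R[3]} :=
  \sum_(j < k.+1) (Ppoly m k)`_j *:
    ((Xt - Xu * Xv) ^+ j * ((1 - Xu ^+ 2) * (1 - Xv ^+ 2)) ^+ (k - j)./2).

Definition Ymx n d k : 'M[{mpoly R[3]}]_((d - k).+1) :=
  \matrix_(i, j) (lambda n k i j *: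
    (horner_alg Xu (Ppoly (n + 2 * k) i) * horner_alg Xv (Ppoly (n + 2 * k) j)
     * Qpoly (n - 1) k)).

Definition Smx n d k : 'M[{mpoly R[3]}]_((d - k).+1) :=
  \matrix_(i, j) (6^-1 *: \sum_(s : 'S_3) mpoly.msym s (Ymx n d k i j)).

Definition evmx u v t n (M : 'M[{mpoly R[3]}]_n) : 'M[R]_n :=
  map_mx (ev3 u v t) M.

Lemma ev3_var u v t : [/\ ev3 u v t Xu = u, ev3 u v t Xv = v & ev3 u v t Xt = t].
Proof.
by split; rewrite /ev3 mpoly.mevalXU /pt3 (tnth_nth 0) /= inordK.
Qed.

Lemma gegenbauer_coef0 lam k j :
  (k < j)%N || odd (k + j) -> (gegenbauer lam k)`_j = 0.
Proof.
elim/ltn_ind: k j => -[|[|k]] IH j /= H.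
- by rewrite coef1; case: j H.
- by rewrite coefZ coefX; case: j H => [|[|j]] //=; rewrite mulr0.
- rewrite coefZ coefB !coefZ coefXM (IH k) //; last by lia.
  case: j H => [|j] H; first by rewrite !(mulr0, subr0).
  by rewrite (IH k.+1) // ?(mulr0, subr0) //=; lia.
Qed.

Lemma chebyshev_coef0 k j : (k < j)%N || odd (k + j) -> (chebyshev k)`_j = 0.
Proof.
elim/ltn_ind: k j => -[|[|k]] IH j /= H.
- by rewrite coef1; case: j H.
- by rewrite coefX; case: j H => [|[|j]].
- rewrite coefB coefZ coefXM (IH k) //; last by lia.
  case: j H => [|j] H; first by rewrite !(mulr0, subr0).
  by rewrite (IH k.+1) // ?(mulr0, subr0) //=; lia.
Qed.

Lemma Ppoly_coef0 m k j : (k < j)%N || odd (k + j) -> (Ppoly m k)`_j = 0.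
Proof.
move=> H; rewrite /Ppoly; case: ifP => _; first exact: chebyshev_coef0.
by rewrite coefZ gegenbauer_coef0 ?mulr0.
Qed.

Lemma QpolyE m k u v t : `|u| < 1 -> `|v| < 1 ->
  let w := (1 - u ^+ 2) * (1 - v ^+ 2) in
  ev3 u v t (Qpoly m k) =
    w `^ (k%:R / 2) * (Ppoly m k).[(t - u * v) / Num.sqrt w].
Proof.
move=> u1 v1 w; have [eU eV eT] := ev3_var u v t.
have w0 : 0 < w.
  by apply: mulr_gt0; rewrite subr_gt0 -real_normK ?num_real// expr_lt1.
have s0 : Num.sqrt w != 0 by rewrite gt_eqF // sqrtr_gt0.
have hw : w `^ (k%:R / 2) = Num.sqrt w ^+ k.
  by rewrite mulrC powRrM powR12_sqrt ?ltW// powR_mulrn ?sqrtr_ge0.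
rewrite {}hw.
have sz : (size (Ppoly m k) <= k.+1)%N.
  by apply/leq_sizeP => j kj; rewrite Ppoly_coef0 // kj.
rewrite (horner_coef_wide _ sz) mulr_sumr /ev3 /Qpoly raddf_sum /=.
apply: eq_bigr => -[j /= jk] _.
rewrite mpoly.mevalZ.
case: (boolP (odd (k + j))) => [Ho | He].
  by rewrite Ppoly_coef0 ?Ho ?orbT // !mul0r mulr0.
rewrite mpoly.mevalM !rmorphXn /= mpoly.mevalM !mpoly.mevalB mpoly.mevalM !rmorphXn /= !mpoly.meval1.
rewrite -!/(ev3 u v t _) eU eV eT -/w [RHS]mulrCA; congr (_ * _).
rewrite expr_div_n [RHS]mulrCA; congr (_ * _).
rewrite -{1}[w](sqr_sqrtr (ltW w0)) -exprM.
have hj : (2 * (k - j)./2 = k - j)%N by lia.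
rewrite {}hj.
by rewrite -expfB_cond // (negbTE s0).
Qed.

End Defs.

(* Main.v *)
(* The terms of the first sum become, after factoring the weights
   sqrt h_i P_i^{n+2k}(e.c) out, values of Q_k^{n-1}(e.c, e.c', c.c') =
   |x|^k |y|^k P_k^{n-1}(x.y / (|x||y|)), where x and y are the projections of
   c and c' to the hyperplane orthogonal to e, a Euclidean space of dimension
   m = n - 1.  By the Gegenbauer differential equation this is a harmonic
   polynomial Z_y in x.  For the Fischer inner product on polynomials, in which
   multiplication by a variable is adjoint to the derivative, Z_y is orthogonal
   to all multiples of |x|^2, while Z_z is a positive multiple of (x.z)^k plus
   such a multiple and pairing with (x.z)^k evaluates at z, up to k!.  Hence
   <Z_y, Z_z> is a positive multiple of Z_y(z), and the kernel Z is a Gram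
   matrix.  The second sum is the sum over e in C of the first ones, because
   permuting u, v, t amounts to permuting the three points. *)
From HB Require Import structures.
Require Import Defs.
From mathcomp Require Import all_boot all_order all_fingroup all_algebra finmap.
From mathcomp Require Import all_classical all_reals all_analysis.
From mathcomp Require Import -(notations) mpoly.
From mathcomp Require Import ring lra zify.

Set Implicit Arguments.
Unset Strict Implicit.
Unset Printing Implicit Defensive.

Import Order.TTheory GRing.Theory Num.Theory.
Local Open Scope ring_scope.

(** * The recurrence and the differential equation of P_k^m *)

Section Recurrence.
Variable R : realType.
Implicit Types (m k : nat) (lam : R).

Lemma gegenbauerSS lam k :
  k.+2%:R *: gegenbauer lam k.+2
  = (2 * (k.+2%:R + lam - 1)) *: ('X * gegenbauer lam k.+1)
    - (k.+2%:R + 2 * lam - 2) *: gegenbauer lam k.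
Proof. by rewrite [in LHS]/= scalerA divff ?scale1r // pnatr_eq0. Qed.

(** The values at 1 are $\binom{k+2\lambda-1}{k}$; this ratio of consecutive ones serves to rescale
    the recurrence to $P_k(1)=1$. *)
Lemma gegenbauer_at1 lam k :
  k.+1%:R * (gegenbauer lam k.+1).[1]
  = (k%:R + 2 * lam) * (gegenbauer lam k).[1].
Proof.
elim: k => [|k IH]; first by rewrite /= !hornerE; ring.
have := congr1 (horner^~ 1) (gegenbauerSS lam k); move: IH.
move: (gegenbauer lam k.+2) (gegenbauer lam k.+1) (gegenbauer lam k) => G2 G1 G0.
rewrite hornerD hornerN !hornerZ hornerM hornerX => IH ->.
transitivity (2 * (k.+2%:R + lam - 1) * G1.[1] - k.+1%:R * G1.[1]); last by ring.
by rewrite IH; ring.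
Qed.

Lemma gegenbauer_at1_gt0 lam k : 0 < lam -> 0 < (gegenbauer lam k).[1].
Proof.
move=> lam0; elim: k => [|k IH]; first by rewrite hornerE.
rewrite -(pmulr_rgt0 _ (ltr0Sn R k)) gegenbauer_at1 mulr_gt0 //.
by rewrite ltr_wpDl // mulr_gt0.
Qed.

Lemma Ppoly0 m : Ppoly R m 0 = 1.
Proof. by rewrite /Ppoly; case: ifP => // _; rewrite /= hornerE invr1 scale1r. Qed.

Lemma Ppoly1 m : (2 <= m)%N -> Ppoly R m 1 = 'X.
Proof.
move=> m2; rewrite /Ppoly; case: eqP => // nm2 /=; rewrite !hornerE scalerA.
rewrite mulVf ?scale1r //.
have : 2%:R < m%:R :> R by rewrite ltr_nat; lia.
by move=> h; apply/eqP; lra.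
Qed.

(* Dividing the Gegenbauer recurrence by C_k(1) gives a recurrence which the
   Chebyshev polynomials satisfy as well, with m = 2. *)
Lemma PpolySS m k : (2 <= m)%N ->
  (k%:R + m%:R - 1) *: Ppoly R m k.+2
  = (2 * k%:R + m%:R) *: ('X * Ppoly R m k.+1) - k.+1%:R *: Ppoly R m k.
Proof.
move=> m2; rewrite /Ppoly; case: eqP => [->|nm2].
  rewrite [Defs.chebyshev _ k.+2]/= scalerBr scalerA -[in RHS]natr1.
  by congr (_ *: _ - _ *: _); ring.
have lam0 : 0 < m%:R / 2 - 1 :> R.
  have : 2%:R < m%:R :> R by rewrite ltr_nat; lia.
  by move=> h; lra.
set lam := m%:R / 2 - 1 in lam0 *.
have -> : m%:R = 2 * lam + 2 :> R by rewrite /lam; field.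
have s0 := gegenbauer_at1_gt0 k lam0; have s1 := gegenbauer_at1_gt0 k.+1 lam0.
have s2 := gegenbauer_at1_gt0 k.+2 lam0.
have e0 := gegenbauer_at1 lam k; have e1 := gegenbauer_at1 lam k.+1.
have kl : 0 < k%:R + 2 * lam by rewrite ltr_wpDl // mulr_gt0.
have k0 : 0 <= k%:R :> R by [].
cbv zeta; set G2 := gegenbauer lam k.+2 in e1 s2 *.
have eG : G2 = k.+2%:R^-1 *: (k.+2%:R *: G2).
  by rewrite scalerA mulVf ?scale1r // pnatr_eq0.
rewrite {2}eG /G2 gegenbauerSS -/G2.
set G1 := gegenbauer lam k.+1 in e0 e1 s1 *.
set G0 := gegenbauer lam k in e0 s0 *.
rewrite -scalerAr !scalerBr !scalerA.
(* The outer values at 1 become multiples of [G1.[1]], so comparing coefficients leaves rational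
   identities for [field]. *)
have {}e1 : G2.[1] = (k.+1%:R + 2 * lam) * G1.[1] / k.+2%:R.
  by rewrite -e1 mulrC mulKf // pnatr_eq0.
have {}e0 : G0.[1] = k.+1%:R * G1.[1] / (k%:R + 2 * lam).
  by rewrite e0 mulrC mulKf // gt_eqF.
congr (_ *: _ - _ *: _); rewrite ?e0 e1 -!natr1; field;
  rewrite ?gt_eqF //; try lra.
Qed.

(** In the recurrence, [Ppoly R m k] has no term of degree $k+2$, so consecutive leading
    coefficients have a positive ratio. This coefficient becomes the positive [b 0] of the zonal
    kernel. *)
Lemma Ppoly_lead_gt0 m k : (2 <= m)%N -> 0 < (Ppoly R m k)`_k.
Proof.
move=> m2; have m2' : 2%:R <= m%:R :> R by rewrite ler_nat.
suff : 0 < (Ppoly R m k)`_k /\ 0 < (Ppoly R m k.+1)`_k.+1 by case.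
elim: k => [|k [IH0 IH1]]; first by rewrite Ppoly0 Ppoly1 // coef1 coefX.
split=> //; have := congr1 (fun p : {poly R} => p`_k.+2) (PpolySS k m2).
rewrite coefB !coefZ coefXM /= (@Ppoly_coef0 _ _ k k.+2) ?leqnSn //.
rewrite mulr0 subr0 => e; have k0 : 0 <= k%:R :> R by [].
rewrite -(@pmulr_rgt0 _ (k%:R + m%:R - 1)); first by rewrite e mulr_gt0 //; lra.
by lra.
Qed.

(** Both relations go through one induction: at $k+1$, the first comes from the differentiated
    recurrence and both relations at $k$, the second from the recurrence and the first relation at
    $k$. *)
Lemma Ppoly_deriv m k : (2 <= m)%N ->
  (1 - 'X ^+ 2) * (Ppoly R m k.+1)^`()
     = k.+1%:R *: (Ppoly R m k - 'X * Ppoly R m k.+1)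
  /\ (1 - 'X ^+ 2) * (Ppoly R m k)^`()
     = (k%:R + m%:R - 2) *: ('X * Ppoly R m k - Ppoly R m k.+1).
Proof.
move=> m2; have m2' : 2%:R <= m%:R :> R by rewrite ler_nat.
elim: k => [|k [IH1 IH0]].
  rewrite Ppoly0 Ppoly1 // derivX (derivC 1) mulr0 !mulr1 subrr scaler0.
  by rewrite scale1r expr2.
have k0 : 0 <= k%:R :> R by [].
have kn0 : (k%:R + m%:R - 1)%:P != 0 :> {poly R}.
  by rewrite polyC_eq0 gt_eqF //; lra.
have rec := PpolySS k m2.
have drec := congr1 (fun p : {poly R} => p^`()) rec.
move: rec drec; rewrite /= derivB !derivZ derivM derivX mul1r -!mul_polyC.
move: IH0 IH1; rewrite -!mul_polyC.
have S1 : k.+1%:R = k%:R + 1 :> R by rewrite natr1.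
have S2 : k.+2%:R = k%:R + 2 :> R by rewrite -addn2 natrD.
rewrite {}S1 {}S2; set P0 := Ppoly R m k; set P1 := Ppoly R m k.+1; set P2 := Ppoly R m k.+2.
move=> IH0 IH1 rec drec.
split; last first.
  rewrite IH1.
  have -> : (k%:R + 1 + m%:R - 2)%:P * ('X * P1 - P2)
     = (k%:R + m%:R - 1)%:P * ('X * P1) - (k%:R + m%:R - 1)%:P * P2 :> {poly R}.
    by rewrite mulrBr; congr (_%:P * _ - _%:P * _); ring.
  by rewrite rec !(polyCD, polyCN, polyCM); ring.
apply: (mulfI kn0); rewrite mulrCA drec.
have -> : (1 - 'X ^+ 2) * ((2 * k%:R + m%:R)%:P * (P1 + 'X * P1^`()) - (k%:R + 1)%:P * P0^`())
  = (2 * k%:R + m%:R)%:P * ((1 - 'X ^+ 2) * P1 + 'X * ((1 - 'X ^+ 2) * P1^`()))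
    - (k%:R + 1)%:P * ((1 - 'X ^+ 2) * P0^`()) by ring.
rewrite IH0 IH1.
have -> : (k%:R + m%:R - 1)%:P * ((k%:R + 2)%:P * (P1 - 'X * P2))
  = (k%:R + 2)%:P * ((k%:R + m%:R - 1)%:P * P1 - 'X * ((k%:R + m%:R - 1)%:P * P2)) by ring.
by rewrite rec !(polyCD, polyCN, polyCM); ring.
Qed.

(* The Gegenbauer differential equation
   (1 - t^2) P'' - (m - 1) t P' + k (k + m - 2) P = 0, coefficientwise. *)
Lemma Ppoly_coef_rec m k j : (2 <= m)%N ->
  j.+2%:R * j.+1%:R * (Ppoly R m k)`_j.+2
  = (j%:R - k%:R) * (j%:R + k%:R + m%:R - 2) * (Ppoly R m k)`_j.
Proof.
move=> m2; set P := Ppoly R m k.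
have : (1 - 'X ^+ 2) * P^`(2) =
  (m%:R - 1) *: ('X * P^`()) - (k%:R * (k%:R + m%:R - 2)) *: P.
  case: k @P => [|k] P.
    rewrite {}/P Ppoly0 derivSn derivn1 (derivC 1) deriv0 !mul0r scale0r.
    by rewrite !mulr0 scaler0 subr0.
  have [e1 e0] := Ppoly_deriv k m2.
  have w0 : 1 - 'X ^+ 2 != 0 :> {poly R}.
    by rewrite -oppr_eq0 opprB -(@size_poly_eq0 R) -polyC1 size_XnsubC.
  (* Differentiating the first relation brings in $P_0'$, with $P_0$ the preceding polynomial. After
     multiplication by $1-X^2$ the second relation removes $P_0'$, and the first then removes
     $P_0$. *)
  have := congr1 (fun p : {poly R} => p^`()) e1.
  rewrite derivSn derivn1 -/P; move: e1 e0; rewrite -!mul_polyC -/P.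
  set P0 := Ppoly R m k; set w := 1 - 'X ^+ 2 => e1 e0.
  have S1 : k.+1%:R = k%:R + 1 :> R by rewrite natr1.
  rewrite {}S1 in e1 *; set K := (k%:R + 1)%:P in e1 *.
  have wE : w = 1 - 'X ^+ 2 by [].
  have dw : w^`() = - (2 * 'X).
    by rewrite derivB (derivC 1) derivXn sub0r /= expr1 mulr_natl.
  move: w wE w0 dw e1 e0 => w wE w0 dw e1 e0.
  rewrite -wE in w0; rewrite (derivM w) dw derivM derivC mul0r add0r derivB derivM derivX mul1r.
  move: e1 e0; rewrite -/(derivn 2 P).
  move: (P^`()) (P^`()^`()) (P0^`()) => P' P'' P0' e1 e0 eD.
  have {e1} eK : K * P0 = w * P' + K * ('X * P) by rewrite e1; ring.
  have {}eD : w * P'' = K * (P0' - (P + 'X * P')) + 2 * 'X * P' by rewrite -eD; ring.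
  apply: (mulfI w0); rewrite eD.
  have -> : w * (K * (P0' - (P + 'X * P')) + 2 * 'X * P')
    = K * (w * P0') - K * w * P - K * 'X * (w * P') + 2 * 'X * (w * P') by ring.
  rewrite e0.
  have -> : K * ((k%:R + m%:R - 2)%:P * ('X * P0 - P))
    = (k%:R + m%:R - 2)%:P * ('X * (K * P0) - K * P) by ring.
  by rewrite eK /K wE !(polyCD, polyCN, polyCM); ring.
move/(congr1 (fun p : {poly R} => p`_j)).
rewrite mulrBl mul1r !coefB !coefZ coefXnM !coefXM !coef_derivn !coef_deriv.
have -> : P`_(2 + j) *+ (2 + j) ^_ 2 = j.+2%:R * j.+1%:R * P`_j.+2.
  by rewrite -[LHS]mulr_natl ffactnSr ffactn1 natrM subn1.
have -> : (if j == 0%N then 0 else P`_j.-1.+1 *+ j.-1.+1) = j%:R * P`_j.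
  by case: (j) => [|i] /=; rewrite ?mul0r // mulr_natl.
have -> : (if (j < 2)%N then 0 else P`_(2 + (j - 2)) *+ (2 + (j - 2)) ^_ 2)
    = j%:R * (j%:R - 1) * P`_j.
  case: (j) => [|[|i]] /=; rewrite ?subrr ?mulr0 ?mul0r //.
  rewrite -[LHS]mulr_natl ffactnSr ffactn1.
  by rewrite natrM !subSS !subn0 add2n -(natr1 i.+1) addrK.
by move=> e; lra.
Qed.
End Recurrence.

(** * The Fischer inner product *)

Section Fischer.
Variables (R : realType) (n : nat).
Implicit Types (p q : {mpoly R[n]}) (y z : 'rV[R]_n) (a : multinom n).

Definition mfact a : nat := \prod_(i < n) (a i)`!.

(** The support of [p] alone suffices as range, since [mcoeff a p] vanishes outside it; symmetry
    then needs a common larger range. *)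
Definition fischer p q : R :=
  \sum_(a <- msupp p) (mfact a)%:R * (mcoeff a p * mcoeff a q).

Lemma fischer_widen s p q : uniq s -> {subset msupp p <= s} ->
  fischer p q = \sum_(a <- s) (mfact a)%:R * (mcoeff a p * mcoeff a q).
Proof.
move=> us sub; rewrite /fischer [RHS](bigID (fun a => a \in msupp p)) /=.
rewrite [X in _ = _ + X]big1 ?addr0; last first.
  by move=> a /memN_msupp_eq0 ->; rewrite mul0r mulr0.
rewrite -[RHS]big_filter; apply: perm_big; apply: uniq_perm.
- exact: msupp_uniq.
- exact: filter_uniq.
- by move=> a; rewrite mem_filter; case: (boolP (a \in msupp p)) => // /sub ->.
Qed.

Lemma fischerC p q : fischer p q = fischer q p.
Proof.
pose s := undup (msupp p ++ msupp q).
have us : uniq s by exact: undup_uniq.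
rewrite (@fischer_widen s p q) ?(@fischer_widen s q p) //.
- by apply: eq_bigr => a _; rewrite [mcoeff a p * _]mulrC.
- by move=> a aq; rewrite mem_undup mem_cat aq orbT.
- by move=> a ap; rewrite mem_undup mem_cat ap.
Qed.

Fact fischer_is_linear p : linear_for *%R (fischer p).
Proof.
move=> c q1 q2; rewrite /fischer mulr_sumr -big_split /=; apply: eq_bigr => a _.
by rewrite mcoeffD mcoeffZ; ring.
Qed.

HB.instance Definition _ p :=
  GRing.isLinear.Build R {mpoly R[n]} R *%R (fischer p) (fischer_is_linear p).

Lemma fischer_suml I (s : seq I) (F : I -> {mpoly R[n]}) q :
  fischer (\sum_(i <- s) F i) q = \sum_(i <- s) fischer (F i) q.
Proof. by rewrite fischerC raddf_sum; apply: eq_bigr => i _; rewrite fischerC. Qed.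

Lemma fischerZl c p q : fischer (c *: p) q = c * fischer p q.
Proof. by rewrite fischerC linearZ /= fischerC. Qed.

Lemma fischer_ge0 p : 0 <= fischer p p.
Proof. by apply: sumr_ge0 => a _; rewrite mulr_ge0 // -expr2 sqr_ge0. Qed.

Lemma mfactD1 a i : mfact (mnm_add a (mnm1 i)) = ((a i).+1 * mfact a)%N.
Proof.
rewrite /mfact (bigD1 i) //= [in RHS](bigD1 i) //= mnmDE mnm1E eqxx addn1 factS.
rewrite mulnA; congr (_ * _)%N; apply: eq_bigr => j ji.
by rewrite mnmDE mnm1E eq_sym (negbTE ji) addn0.
Qed.

(** Multiplication by a variable shifts the exponents by one unit, and the weight grows by the same
    factor [(a i).+1] that differentiation produces. *)
Lemma fischer_deriv i p q :
  fischer (mpolyX R (mnm1 i) * p) q = fischer p (mderiv i q).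
Proof.
rewrite mulrC /fischer (perm_big _ (msuppMX p (mnm1 i))) /= big_map.
apply: eq_bigr => a _; rewrite mcoeffMX addmC mcoeff_deriv mfactD1 natrM.
by rewrite -mulr_natl; ring.
Qed.

Definition linform y : {mpoly R[n]} := \sum_(i < n) y 0 i *: mpolyX R (mnm1 i).
Definition quadform : {mpoly R[n]} := \sum_(i < n) mpolyX R (mnm1 i) ^+ 2.
Definition laplace p : {mpoly R[n]} := \sum_(i < n) mderiv i (mderiv i p).

Fact laplace_is_linear : linear laplace.
Proof.
move=> c p q; rewrite /laplace scaler_sumr -big_split /=.
by apply: eq_bigr => i _; rewrite !linearP.
Qed.

HB.instance Definition _ :=
  GRing.isLinear.Build R {mpoly R[n]} {mpoly R[n]} *:%R laplace laplace_is_linear.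

Lemma fischer_laplace p q : fischer (quadform * p) q = fischer p (laplace q).
Proof.
rewrite /quadform mulr_suml fischer_suml /laplace linear_sum; apply: eq_bigr => i _.
by rewrite expr2 -mulrA !fischer_deriv.
Qed.

Lemma mderiv_exp i p k : mderiv i (p ^+ k) = k%:R *: (p ^+ k.-1 * mderiv i p).
Proof.
elim: k => [|k IH]; first by rewrite expr0 -(mpolyC1 n R) mderivC scale0r.
rewrite exprS mderivM IH /= -scalerAr -natr1 scalerDl scale1r addrC.
rewrite [mderiv i p * _]mulrC; congr (_ + _).
by case: k {IH} => [|k] /=; rewrite ?scale0r // mulrA -exprS.
Qed.

Lemma mderiv_var (i j : 'I_n) : mderiv i (mpolyX R (mnm1 j)) = (i == j)%:R.
Proof.
rewrite mderivX mnm1E eq_sym; case: eqP => [->|_]; last by rewrite scale0r.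
by rewrite scale1r -[X in mnm_sub X _]add0m addmK mpolyX0.
Qed.

Lemma mderiv_linform i y : mderiv i (linform y) = mpolyC n (y 0 i).
Proof.
rewrite linear_sum (bigD1 i) //= big1 => [|j ji].
  by rewrite addr0 mderivZ mderiv_var eqxx alg_mpolyC.
by rewrite mderivZ mderiv_var eq_sym (negbTE ji) scaler0.
Qed.

Lemma mderiv_linform_exp i y k :
  mderiv i (linform y ^+ k) = (k%:R * y 0 i) *: linform y ^+ k.-1.
Proof.
by rewrite mderiv_exp mderiv_linform [_ * mpolyC n _]mulrC mul_mpolyC scalerA.
Qed.

Lemma fischer_linform z p y k :
  fischer (linform z * p) (linform y ^+ k.+1)
  = k.+1%:R * dotp z y * fischer p (linform y ^+ k).
Proof.
transitivity (\sum_(i < n) k.+1%:R * (z 0 i * y 0 i) * fischer p (linform y ^+ k)).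
  rewrite [X in fischer (X * _)]/linform mulr_suml fischer_suml.
  apply: eq_bigr => i _; rewrite -scalerAl fischerZl fischer_deriv.
  by rewrite mderiv_linform_exp linearZ /=; ring.
by rewrite -mulr_suml -mulr_sumr.
Qed.

Lemma laplace_linform y k :
  laplace (linform y ^+ k.+2)
  = (k.+2%:R * k.+1%:R * dotp y y) *: linform y ^+ k.
Proof.
rewrite /laplace /dotp mulr_sumr scaler_suml; apply: eq_bigr => i _.
rewrite mderiv_linform_exp mderivZ mderiv_linform_exp scalerA.
by congr (_ *: _); rewrite /=; ring.
Qed.

(** Up to a factorial this is evaluation at $y$. Factors $|x|^2$ are moved across as Laplacians,
    factors $x\cdot z$ as derivatives in direction $z$, and each move releases the next factors of
    the factorial. *)
Lemma fischer_linform_pow y z j r :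
  fischer (linform z ^+ j * quadform ^+ r) (linform y ^+ (j + r.*2))
  = (j + r.*2)`!%:R * (dotp z y ^+ j * dotp y y ^+ r).
Proof.
elim: r => [|r IH] in j *.
  elim: j => [|j IH].
    rewrite !expr0 mul1r mulr1 /fischer msupp1 big_seq1 mcoeff1 eqxx !mulr1.
    by rewrite /mfact big1 // => i _; rewrite mnm0E fact0.
  by rewrite exprS -mulrA addSn fischer_linform IH factS natrM !exprS; ring.
rewrite exprS mulrCA fischer_laplace doubleS !addnS laplace_linform linearZ /=.
by rewrite IH !factS !natrM exprS; ring.
Qed.

End Fischer.

(** * Zonal harmonics *)

Section ZonalHarmonics.
Variables (R : realType) (n : nat).
Implicit Types (p q : {mpoly R[n]}) (x y z : 'rV[R]_n).

Local Notation "'\l' y" := (linform y) (at level 9, y at level 8).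
Local Notation qf := (quadform R n).

Lemma mderiv_quadform_exp i r :
  mderiv i (qf ^+ r) = (2 * r%:R) *: (qf ^+ r.-1 * mpolyX R (mnm1 i)).
Proof.
have dq : mderiv i qf = 2 *: mpolyX R (mnm1 i).
  rewrite linear_sum (bigD1 i) //= big1 => [|j ji].
    by rewrite addr0 mderiv_exp mderiv_var eqxx mulr1 expr1.
  by rewrite mderiv_exp mderiv_var eq_sym (negbTE ji) mulr0 scaler0.
by rewrite mderiv_exp dq -scalerAr scalerA mulrC.
Qed.

Lemma laplaceM p q : laplace (p * q) = laplace p * q + p * laplace q
  + 2 *: \sum_(i < n) mderiv i p * mderiv i q.
Proof.
rewrite /laplace mulr_suml mulr_sumr scaler_sumr -!big_split /=.
apply: eq_bigr => i _; rewrite !(mderivM, mderivD) scaler_nat.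
by rewrite mulr2n; ring.
Qed.

Lemma laplace_quadform_exp r :
  laplace (qf ^+ r) = (2 * r * (2 * r.-1 + n))%:R *: qf ^+ r.-1.
Proof.
transitivity (\sum_(i < n) ((2 * r%:R) * (2 * r.-1%:R)) *:
                 (qf ^+ r.-2 * mpolyX R (mnm1 i) ^+ 2)
              + \sum_(i < n) (2 * r%:R) *: qf ^+ r.-1).
  rewrite -big_split; apply: eq_bigr => i _ /=.
  rewrite mderiv_quadform_exp mderivZ mderivM mderiv_quadform_exp mderiv_var eqxx.
  by rewrite mulr1 scalerDr -scalerAl scalerA -[_ ^+ _ * _ * _]mulrA.
rewrite -scaler_sumr -mulr_sumr -exprSr sumr_const card_ord -[_ *+ n]scaler_nat scalerA.
(* For $r\le 1$ the truncated exponents occur only with zero coefficients. *)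
case: r => [|[|r]] /=.
- by rewrite !(mulr0, mul0r, muln0, mul0n) !scale0r addr0.
- by rewrite !(mulr0, muln0) scale0r add0r; congr (_ *: _); rewrite !natrM; ring.
- by rewrite -scalerDl; congr (_ *: _); rewrite !(natrM, natrD); ring.
Qed.

Lemma laplace_linform_exp y j :
  laplace (\l y ^+ j) = ((j * j.-1)%:R * dotp y y) *: \l y ^+ j.-2.
Proof.
case: j => [|[|j]]; last by rewrite laplace_linform natrM.
  rewrite mul0r scale0r expr0 /laplace big1 // => i _.
  by rewrite -mpolyC1 !mderivC.
rewrite mul0r scale0r expr1 /laplace big1 // => i _.
by rewrite mderiv_linform mderivC.
Qed.

(** The cross term of the product rule contains $\sum_i y_i x_i$, which restores the factor $x\cdot
    y$ lost by differentiation, so it merges with the Laplacian of $|x|^{2r}$. *)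
Lemma laplace_zonal_term y j r :
  laplace (\l y ^+ j * qf ^+ r)
  = ((j * j.-1)%:R * dotp y y) *: (\l y ^+ j.-2 * qf ^+ r)
    + (2 * r * (2 * j + 2 * r.-1 + n))%:R *: (\l y ^+ j * qf ^+ r.-1).
Proof.
rewrite laplaceM laplace_linform_exp laplace_quadform_exp -scalerAl -scalerAr.
rewrite -addrA; congr (_ + _).
have -> : \sum_(i < n) mderiv i (\l y ^+ j) * mderiv i (qf ^+ r)
    = (2 * r * j)%:R *: (\l y ^+ j * qf ^+ r.-1).
  transitivity (\sum_(i < n) (2 * r * j)%:R *:
      (\l y ^+ j.-1 * qf ^+ r.-1 * (y 0 i *: mpolyX R (mnm1 i)))).
    apply: eq_bigr => i _; rewrite mderiv_linform_exp mderiv_quadform_exp.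
    rewrite -scalerAl -!scalerAr !scalerA; congr (_ *: _); last by rewrite mulrA.
    by rewrite !natrM; ring.
  rewrite -scaler_sumr -mulr_sumr -/(linform y) mulrAC -exprSr.
  by case: j => [|j] //; rewrite muln0 !scale0r.
rewrite scalerA -scalerDl; congr (_ *: _).
by rewrite -(natrM _ 2) -natrD; congr (_%:R); ring.
Qed.

Variables (k : nat) (b : nat -> R).

(* |x|^k |y|^k P(x.y / (|x||y|)), where b r is the coefficient of degree
   k - 2 r in P, as a polynomial in x and as a number. *)
Definition zonal_poly y : {mpoly R[n]} :=
  \sum_(r < k./2.+1) (b r * dotp y y ^+ r) *: (\l y ^+ (k - r.*2) * qf ^+ r).

Definition zonal y z : R :=
  \sum_(r < k./2.+1) b r * (dotp y z ^+ (k - r.*2) * (dotp y y * dotp z z) ^+ r).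

(** This is the vanishing of the coefficient of $(x\cdot y)^{k-2r-2}|x|^{2r}$ in the Laplacian of
    [zonal_poly y], up to a power of $|y|^2$. *)
Hypothesis b_rec : forall r, (r < k./2)%N ->
  ((k - r.*2) * (k - r.*2).-1)%:R * b r
  + (2 * r.+1 * (2 * (k - r.+1.*2) + 2 * r + n))%:R * b r.+1 = 0.

Lemma zonal_poly_harmonic y : laplace (zonal_poly y) = 0.
Proof.
rewrite linear_sum /=.
under eq_bigr => r _ do rewrite linearZ /= laplace_zonal_term scalerDr !scalerA.
(* The first sum loses its last term, as $k-2\lfloor k/2\rfloor$ is 0 or 1, and the second its
   first; the rest pairs $r$ with $r+1$ on a common monomial. *)
rewrite big_split /= big_ord_recr [X in _ + X]big_ord_recl /=.
rewrite muln0 mul0n mulr0 scale0r add0r.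
have -> : ((k - k./2.*2) * (k - k./2.*2).-1 = 0)%N by lia.
rewrite mul0r mulr0 scale0r addr0 -big_split big1 //= => r _.
rewrite /bump /= add1n -(_ : k - r.*2 - 2 = k - r.+1.*2)%N; last by lia.
rewrite subn2 -scalerDl; apply/eqP; rewrite scaler_eq0; apply/orP; left; apply/eqP.
have := b_rec (ltn_ord r); rewrite /= -(_ : k - r.*2 - 2 = k - r.+1.*2)%N; last by lia.
rewrite subn2 => e.
transitivity (dotp y y ^+ r.+1 * 0); last by rewrite mulr0.
by rewrite -e exprS; ring.
Qed.

Lemma fischer_zonal_poly y z :
  fischer (zonal_poly y) (zonal_poly z) = b 0 * k`!%:R * zonal y z.
Proof.
(* Past $r=0$ all terms share the factor [qf], whose adjoint, the Laplacian, annihilates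
   [zonal_poly y]. *)
rewrite [zonal_poly z]/zonal_poly big_ord_recl /= double0 subn0 expr0 mulr1.
rewrite raddfD /=.
have -> : \sum_(r < k./2) (b (bump 0 r) * dotp z z ^+ bump 0 r) *:
    (\l z ^+ (k - (bump 0 r).*2) * qf ^+ bump 0 r)
  = qf * \sum_(r < k./2) (b r.+1 * dotp z z ^+ r.+1) *:
      (\l z ^+ (k - r.+1.*2) * qf ^+ r).
  rewrite mulr_sumr; apply: eq_bigr => r _; rewrite /bump /= add1n.
  by rewrite -scalerAr mulrCA -exprS.
rewrite [X in _ + X]fischerC fischer_laplace.
rewrite zonal_poly_harmonic linear0 addr0.
rewrite expr0 mulr1 linearZ /= -mulrA; congr (_ * _).
rewrite fischer_suml /zonal mulr_sumr; apply: eq_bigr => r _.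
have kr : (k - r.*2 + r.*2 = k)%N by have := ltn_ord r; lia.
have := fischer_linform_pow z y (k - r.*2) r; rewrite kr fischerZl => ->.
by rewrite exprMn; ring.
Qed.

(** Up to the factor $b_0\,k!>0$, the double sum is the Fischer square of $\sum_c w_c Z_{y_c}$. *)
Lemma zonal_psd (b0 : 0 < b 0) (T : Type) (s : seq T) (w : T -> R)
    (y : T -> 'rV[R]_n) :
  0 <= \sum_(c <- s) \sum_(c' <- s) w c * w c' * zonal (y c) (y c').
Proof.
have bk : 0 < b 0 * k`!%:R by rewrite mulr_gt0 // ltr0n fact_gt0.
rewrite -(pmulr_rge0 _ bk).
have := fischer_ge0 (\sum_(c <- s) w c *: zonal_poly (y c)).
rewrite fischer_suml mulr_sumr; congr (0 <= _); apply: eq_bigr => c _.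
rewrite linear_sum mulr_sumr; apply: eq_bigr => c' _.
by rewrite linearZ /= fischerZl fischer_zonal_poly; ring.
Qed.

End ZonalHarmonics.

(** * The kernel Q_k^{n-1} on the sphere *)

Section DotProduct.
Variable R : realType.
Implicit Types (a : R) (n : nat).

Lemma dotpC n (x y : 'rV[R]_n) : dotp x y = dotp y x.
Proof. by apply: eq_bigr => i _; rewrite mulrC. Qed.

Lemma dotpBl n (x y z : 'rV[R]_n) : dotp (x - y) z = dotp x z - dotp y z.
Proof. by rewrite -sumrB; apply: eq_bigr => i _; rewrite !mxE mulrBl. Qed.

Lemma dotpZl n a (x z : 'rV[R]_n) : dotp (a *: x) z = a * dotp x z.
Proof. by rewrite mulr_sumr; apply: eq_bigr => i _; rewrite mxE mulrA. Qed.

Lemma dotp_recl n (x y : 'rV[R]_n.+1) : dotp x y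
  = x 0 0 * y 0 0 + dotp (\row_i x 0 (lift ord0 i)) (\row_i y 0 (lift ord0 i)).
Proof.
by rewrite /dotp big_ord_recl; congr (_ + _); apply: eq_bigr => i _; rewrite !mxE.
Qed.

Lemma dotp_eq0 n (x : 'rV[R]_n) : dotp x x = 0 -> x = 0.
Proof.
move=> /eqP; rewrite psumr_eq0 => [/allP h|i _]; last by rewrite -expr2 sqr_ge0.
apply/rowP => i; rewrite mxE; apply/eqP.
by have := h i (mem_index_enum i); rewrite mulf_eq0 orbb.
Qed.

(* Coordinates on the hyperplane orthogonal to a unit vector e: reflect e to
   a multiple of the first basis vector and drop the first coordinate.  If
   e is minus the first basis vector, the division by zero makes the map just
   drop the first coordinate, which is still right. *)
Definition hyperplane_coord n (e x : 'rV[R]_n.+1) : 'rV[R]_n :=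
  \row_i x 0 (lift ord0 i) - (x 0 0 / (1 + e 0 0)) *: \row_i e 0 (lift ord0 i).

Lemma dotp_hyperplane_coord n (e x y : 'rV[R]_n.+1) :
  dotp e e = 1 -> dotp x e = 0 -> dotp y e = 0 ->
  dotp (hyperplane_coord e x) (hyperplane_coord e y) = dotp x y.
Proof.
rewrite /hyperplane_coord !dotp_recl dotpBl dotpZl.
move: (\row_i e 0 _) (\row_i x 0 _) (\row_i y 0 _) => e' x' y'.
move: (e 0 0) (x 0 0) (y 0 0) => e0 x0 y0 ee xe ye.
rewrite ![dotp _ (y' - _)]dotpC !dotpBl !dotpZl [dotp e' x']dotpC.
rewrite (dotpC y' x').
have -> : dotp x' e' = - (x0 * e0) by lra.
have -> : dotp y' e' = - (y0 * e0) by lra.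
have [e1|e1] := eqVneq (1 + e0) 0; last first.
  have -> : dotp e' e' = (1 - e0) * (1 + e0) by nra.
  by field.
(* Now $|e|=1$ forces [e'] to vanish, and orthogonality to $e$ forces [x0] to vanish. *)
have e0E : e0 = -1 by lra.
have e'0 : e' = 0 by apply: dotp_eq0; move: ee; rewrite e0E; lra.
have x00 : x0 = 0.
  have x'e' : dotp x' e' = 0.
    by rewrite e'0 /dotp big1 // => i _; rewrite mxE mulr0.
  by move: xe; rewrite x'e' e0E; lra.
by rewrite x00 !mul0r; ring.
Qed.

End DotProduct.

(** * Positivity of $Q_k^{n-1}$ via projections to a hyperplane *)

Section QKernel.
Variable R : realType.
Implicit Types (m n k : nat) (u v t : R).

Lemma sum_even k (F : nat -> R) : (forall i, odd i -> F i = 0) ->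
  \sum_(i < k.+1) F i = \sum_(r < k./2.+1) F r.*2.
Proof.
move=> F0; elim: k => [|k IH]; first by rewrite !big_ord1.
rewrite big_ord_recr IH /=; case: (boolP (odd k)) => ok.
  rewrite uphalf_half ok add1n [in RHS]big_ord_recr /=; congr (_ + F _).
  by lia.
by rewrite uphalf_half (negbTE ok) F0 ?addr0.
Qed.

(** Parity leaves only the degrees $k-2r$. The result has the shape of [zonal] and covers
    $u,v=\pm1$, where the quotient in the definition of $Q$ degenerates. *)
Lemma ev3_Qpoly m k u v t : ev3 u v t (Qpoly R m k)
  = \sum_(r < k./2.+1) (Ppoly R m k)`_(k - r.*2) *
      ((t - u * v) ^+ (k - r.*2) * ((1 - u ^+ 2) * (1 - v ^+ 2)) ^+ r).
Proof.
have [eU eV eT] := ev3_var u v t.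
transitivity (\sum_(j < k.+1) (Ppoly R m k)`_j *
  ((t - u * v) ^+ j * ((1 - u ^+ 2) * (1 - v ^+ 2)) ^+ (k - j)./2)).
  rewrite /ev3 /Qpoly raddf_sum; apply: eq_bigr => j _; rewrite /= mevalZ mevalM.
  rewrite !rmorphXn /= mevalM !mevalB mevalM !rmorphXn /= !meval1.
  by rewrite -!/(ev3 u v t _) eU eV eT.
(* Beyond $k$ the truncated [k - i] would select the constant coefficient, which may be nonzero at
   odd [i]; hence the guard. *)
pose F i : R := if (i <= k)%N then (Ppoly R m k)`_(k - i) *
  ((t - u * v) ^+ (k - i) * ((1 - u ^+ 2) * (1 - v ^+ 2)) ^+ i./2) else 0.
rewrite (reindex_inj rev_ord_inj) /=.
transitivity (\sum_(i < k.+1) F i).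
  apply: eq_bigr => i _; rewrite subSS /F; have ik : (i <= k)%N by rewrite -ltnS.
  by rewrite ik subKn.
rewrite sum_even => [|i oi]; last first.
  by rewrite /F; case: ifP => // ik; rewrite Ppoly_coef0 ?mul0r //; lia.
apply: eq_bigr => r _; rewrite /F doubleK ifT //.
by have := ltn_ord r; lia.
Qed.

(** For the projections of $c$ and $c'$ to $e^\perp$, the inner product is $t-uv$ and the squared
    norms are $1-u^2$, $1-v^2$; the kernel is thus [zonal] in dimension $n-1$. *)
Lemma Qkernel_psd n k (hn : (3 <= n)%N) (e : 'rV[R]_n) (C : seq 'rV[R]_n)
    (w : 'rV[R]_n -> R) :
  unit_sphere e -> (forall c, c \in C -> unit_sphere c) ->
  0 <= \sum_(c <- C) \sum_(c' <- C) w c * w c' *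
         ev3 (dotp e c) (dotp e c') (dotp c c') (Qpoly R (n - 1) k).
Proof.
case: n hn e C w => // m hm e C w; rewrite subn1 /=.
have m2 : (2 <= m)%N by [].
rewrite /unit_sphere /= => ee hC.
pose b r := (Ppoly R m k)`_(k - r.*2).
pose y c := hyperplane_coord e (c - dotp e c *: e).
have orth c : dotp (c - dotp e c *: e) e = 0.
  by rewrite dotpBl dotpZl ee mulr1 dotpC subrr.
have yy c c' : dotp (y c) (y c') = dotp c c' - dotp e c * dotp e c'.
  rewrite dotp_hyperplane_coord // [LHS]dotpC dotpBl dotpZl.
  by rewrite (dotpC e (c - _)) orth mulr0 subr0 dotpC dotpBl dotpZl.
have b_rec r : (r < k./2)%N -> ((k - r.*2) * (k - r.*2).-1)%:R * b r
    + (2 * r.+1 * (2 * (k - r.+1.*2) + 2 * r + m))%:R * b r.+1 = 0.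
  (* In degree $j=k-2r-2$ one has $j-k=-2(r+1)$ and $j+k+m-2=2j+2r+m$, the factors of the
     harmonicity condition. *)
  move=> rk; have := Ppoly_coef_rec R k (k - r.+1.*2) m2.
  have kr : (k - r.*2 = (k - r.+1.*2).+2)%N by lia.
  have kE : k%:R = (k - r.+1.*2)%:R + 2 * r%:R + 2 :> R.
    rewrite -natrM -!natrD; congr (_%:R); lia.
  rewrite /b kr kE => e1; rewrite !natrM [_.+2.-1]/= e1.
  by ring.
have b0 : 0 < b 0 by rewrite /b subn0 Ppoly_lead_gt0.
have := zonal_psd b_rec b0 C w y; congr (0 <= _).
rewrite !big_seq; apply: eq_bigr => c cC; rewrite !big_seq.
apply: eq_bigr => c' c'C; congr (_ * _).
by rewrite ev3_Qpoly; apply: eq_bigr => r _; rewrite !yy !hC // !expr2.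
Qed.

End QKernel.

(** * The matrices Y_k^n and S_k^n *)

Section Symmetrization.
Variable R : realType.
Implicit Types (n d k : nat) (u v t : R).

Lemma Gamma_ge0 (x : R) : 0 <= Gamma x.
Proof.
by apply: Rintegral_ge0 => y _; rewrite mulr_ge0 ?powR_ge0 ?expR_ge0.
Qed.

Lemma omega_ge0 n : 0 <= omega R n.
Proof. by rewrite /omega divr_ge0 ?Gamma_ge0 // mulr_ge0 ?powR_ge0. Qed.

Lemma harm_dim_ge0 n i : (0 < n)%N -> 0 <= harm_dim R n i.
Proof. by move=> n0; rewrite subr_ge0 ler_nat leq_bin2l; lia. Qed.

Lemma lambdaC n k i j : lambda R n k i j = lambda R n k j i.
Proof. by rewrite /lambda [_ _ i * _]mulrC. Qed.

Lemma horner_alg_rmorph (A B : comAlgType R) (f : {lrmorphism A -> B})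
    (a : A) (p : {poly R}) :
  f (horner_alg a p) = horner_alg (f a) p.
Proof.
elim/poly_ind: p => [|p c IH]; first by rewrite !rmorph0.
by rewrite !(rmorphD, rmorphM) /= !horner_algX !horner_algC IH rmorph_alg.
Qed.

Lemma ev3_horner_alg u v t (X : {mpoly R[3]}) (p : {poly R}) :
  ev3 u v t (horner_alg X p) = p.[ev3 u v t X].
Proof.
rewrite /ev3; elim/poly_ind: p => [|p c IH]; first by rewrite !rmorph0 horner0.
rewrite !(rmorphD, rmorphM) /= horner_algX horner_algC IH hornerMXaddC.
by rewrite mevalZ meval1 mulr1.
Qed.

Lemma ev3_Ymx n d k u v t i j : ev3 u v t (Ymx R n d k i j)
  = lambda R n k i j * ((Ppoly R (n + 2 * k) i).[u] * (Ppoly R (n + 2 * k) j).[v]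
      * ev3 u v t (Qpoly R (n - 1) k)).
Proof.
have [eU eV _] := ev3_var u v t.
by rewrite mxE /ev3 mevalZ !mevalM -!/(ev3 u v t _) !ev3_horner_alg eU eV.
Qed.

Lemma ev3_Qpoly_swap m k u v t :
  ev3 u v t (Qpoly R m k) = ev3 v u t (Qpoly R m k).
Proof.
rewrite !ev3_Qpoly; apply: eq_bigr => r _.
by rewrite [v * u]mulrC [(1 - v ^+ 2) * _]mulrC.
Qed.

Lemma ev3_Ymx_swap n d k u v t i j :
  ev3 u v t (Ymx R n d k i j) = ev3 v u t (Ymx R n d k j i).
Proof.
by rewrite !ev3_Ymx lambdaC ev3_Qpoly_swap [_.[u] * _]mulrC.
Qed.

(** Since $\lambda_{i,j}=a\,h_ih_j$, the dependence on $(i,c)$ and $(j,c')$ separates, and the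
    quadratic form is $a$ times that of the kernel $Q$ with weights [w c]. *)
Lemma psdmx_Ymx n d k (hn : (3 <= n)%N) (e : 'rV[R]_n) (C : {fset 'rV[R]_n}) :
  unit_sphere e -> (forall c, c \in C -> unit_sphere c) ->
  psdmx (\sum_(c <- C) \sum_(c' <- C)
           evmx (dotp e c) (dotp e c') (dotp c c') (Ymx R n d k)).
Proof.
move=> he hC; set M := \sum_(c <- C) _.
have ME i j : M i j = \sum_(c <- C) \sum_(c' <- C)
    ev3 (dotp e c) (dotp e c') (dotp c c') (Ymx R n d k i j).
  by rewrite summxE; apply: eq_bigr => c _; rewrite summxE;
     apply: eq_bigr => c' _; rewrite mxE.
split.
  apply/matrixP => i j; rewrite mxE !ME exchange_big /=.
  apply: eq_bigr => c _; apply: eq_bigr => c' _.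
  by rewrite ev3_Ymx_swap (dotpC c).
move=> x.
pose h i := Num.sqrt (harm_dim R (n + 2 * k) i).
pose w c := \sum_(i < (d - k).+1) x i 0 * h i * (Ppoly R (n + 2 * k) i).[dotp e c].
pose a := omega R n / omega R (n - 1)
  * (omega R (n + 2 * k - 1) / omega R (n + 2 * k)).
(* A quotient of nonnegative numbers is nonnegative, also over a zero denominator. *)
have a0 : 0 <= a by apply: mulr_ge0; apply: divr_ge0; exact: omega_ge0.
have lamE i j : lambda R n k i j = a * (h i * h j).
  by rewrite /lambda sqrtrM // harm_dim_ge0 //; lia.
have -> : (x^T *m M *m x) 0 0 = a * \sum_(c <- C) \sum_(c' <- C) w c * w c' *
    ev3 (dotp e c) (dotp e c') (dotp c c') (Qpoly R (n - 1) k).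
  rewrite mxE.
  under eq_bigr => j _.
    rewrite mxE mulr_suml.
    under eq_bigr => i _ do rewrite mxE ME mulr_sumr mulr_suml.
    over.
  rewrite exchange_big /=.
  under eq_bigr => i _ do rewrite exchange_big /=.
  rewrite exchange_big /= mulr_sumr; apply: eq_bigr => c _.
  rewrite mulr_sumr.
  under eq_bigr => i _.
    under eq_bigr => j _ do rewrite mulr_sumr mulr_suml.
    rewrite exchange_big /=.
    over.
  rewrite exchange_big /=; apply: eq_bigr => c' _.
  rewrite /w big_distrlr /= mulr_suml mulr_sumr; apply: eq_bigr => i _.
  rewrite mulr_suml mulr_sumr; apply: eq_bigr => j _.
  by rewrite ev3_Ymx lamE; ring.
by rewrite mulr_ge0 //; exact: (Qkernel_psd _ hn).
Qed.

Lemma psdmx_sum n (I : eqType) (s : seq I) (M : I -> 'M[R]_n) :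
  (forall i, i \in s -> psdmx (M i)) -> psdmx (\sum_(i <- s) M i).
Proof.
elim: s => [|i s IH] H.
  rewrite big_nil; split; first by rewrite trmx0.
  by move=> x; rewrite mulmx0 mul0mx mxE.
rewrite big_cons; have [Mt Mx] := H i (mem_head _ _).
have [j js|St Sx] := IH; first by apply: H; rewrite in_cons js orbT.
split; first by rewrite raddfD /= Mt St.
by move=> x; rewrite mulmxDr mulmxDl mxE addr_ge0.
Qed.

(** * Permutations of the variables and the average over $S_3$ *)

Lemma msym_comp n (s s' : 'S_n) (p : {mpoly R[n]}) :
  msym s (msym s' p) = msym (s' * s)%g p.
Proof.
apply/mpolyP => a; rewrite !mcoeff_sym; congr (mcoeff _ p).
by apply/mnmP => i; rewrite !mnmE permM.
Qed.

Lemma meval_msym n (s : 'S_n) (f : 'I_n -> R) (p : {mpoly R[n]}) :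
  meval f (msym s p) = meval (fun i => f (s i)) p.
Proof.
rewrite [p]mpolyE (raddf_sum (msym s)) !raddf_sum; apply: eq_bigr => a _ /=.
rewrite msymZ !mevalZ msymX !mevalX; congr (_ * _).
rewrite (reindex_inj (@perm_inj _ s)) /=.
by apply: eq_bigr => i _; rewrite mnmE permK.
Qed.

Lemma Ymx_tperm n d k i j :
  msym (tperm (inord 0) (inord 1)) (Ymx R n d k i j) = Ymx R n d k j i.
Proof.
set s := tperm _ _.
have msymV (l : 'I_3) : msym s (var R l) = var R (s l).
  apply/mpolyP => a; rewrite /var mcoeff_sym !mcoeffX.
  congr (_ : bool)%:R; apply/eqP/eqP => [/mnmP h|<-]; apply/mnmP => q.
    by have := h (s^-1 q)%g; rewrite !mnmE permKV => <-; rewrite (canF_eq (permK s)).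
  by rewrite !mnmE (inj_eq perm_inj).
have su : msym s (Xu R) = Xv R by rewrite /Xu msymV tpermL.
have sv : msym s (Xv R) = Xu R by rewrite /Xv msymV tpermR.
have st : msym s (Xt R) = Xt R.
  by rewrite /Xt msymV tpermD // -val_eqE /= !inordK.
rewrite !mxE msymZ !msymM !(horner_alg_rmorph (msym s)) /= su sv lambdaC.
congr (_ *: (_ * _)); first by rewrite mulrC.
rewrite (raddf_sum (msym s)); apply: eq_bigr => l _ /=; rewrite msymZ msymM !(rmorphXn (msym s)).
rewrite /= msymM !msymB msymM !(rmorphXn (msym s)) !msym1 /= su sv st.
by rewrite [Xv R * _]mulrC [(1 - Xv R ^+ 2) * _]mulrC.
Qed.

(** Transposing $Y$ is the action of the exchange of $u$ and $v$, which the average over the group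
    absorbs by a left translation. *)
Lemma trmx_Smx n d k : (Smx R n d k)^T = Smx R n d k.
Proof.
apply/matrixP => i j; rewrite [LHS]mxE [LHS]mxE [RHS]mxE -(Ymx_tperm _ i j).
congr (_ *: _).
rewrite [RHS](reindex_inj (mulgI (tperm (inord 0) (inord 1)))) /=.
by apply: eq_bigr => s _; rewrite msym_comp.
Qed.

Lemma Smx_symmetric n d k i j : Smx R n d k i j \is @symmetric 3 R.
Proof.
apply/issymP => s; rewrite mxE msymZ (raddf_sum (msym s)); congr (_ *: _).
rewrite [RHS](reindex_inj (mulIg s)) /=.
by apply: eq_bigr => s' _; rewrite msym_comp.
Qed.

(* Every permutation of the three inner products of a triple of points comes
   from a permutation of the points. *)
Lemma sum_triples_msym n (C : seq 'rV[R]_n) (s : 'S_3) (p : {mpoly R[3]}) :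
  \sum_(c <- C) \sum_(c' <- C) \sum_(c'' <- C)
     ev3 (dotp c c') (dotp c c'') (dotp c' c'') (msym s p)
  = \sum_(c <- C) \sum_(c' <- C) \sum_(c'' <- C)
     ev3 (dotp c c') (dotp c c'') (dotp c' c'') p.
Proof.
pose T (F : 'rV[R]_n -> 'rV[R]_n -> 'rV[R]_n -> R) :=
  \sum_(c <- C) \sum_(c' <- C) \sum_(c'' <- C) F c c' c''.
have T12 F : T F = T (fun c c' c'' => F c' c c'') by rewrite /T exchange_big.
have T23 F : T F = T (fun c c' c'' => F c c'' c').
  by rewrite /T; apply: eq_bigr => c _; rewrite exchange_big.
have ext F G : (forall c c' c'', F c c' c'' = G c c' c'') -> T F = T G.
  by move=> FG; do 3!(apply: eq_bigr => ? _); exact: FG.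
pose G u v t := meval (pt3 u v t) p.
have evs u v t : ev3 u v t (msym s p)
   = G (pt3 u v t (s (inord 0))) (pt3 u v t (s (inord 1))) (pt3 u v t (s (inord 2))).
  rewrite /ev3 meval_msym; apply: meval_eq => i.
  have := ev3_var (pt3 u v t (s (inord 0))) (pt3 u v t (s (inord 1)))
            (pt3 u v t (s (inord 2))).
  rewrite /ev3 /Xu /Xv /Xt /var !mevalXU => -[e0 e1 e2].
  have : [|| i == inord 0, i == inord 1 | i == inord 2].
    by case: i => [[|[|[|i]]] ?] //; rewrite -!val_eqE /= !inordK.
  by case/or3P => /eqP ->.
have pt0 u v t : pt3 u v t (inord 0) = u.
  by have [] := ev3_var u v t; rewrite /ev3 /Xu /var mevalXU.
have pt1 u v t : pt3 u v t (inord 1) = v.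
  by have [_ + _] := ev3_var u v t; rewrite /ev3 /Xv /var mevalXU.
have pt2 u v t : pt3 u v t (inord 2) = t.
  by have [_ _] := ev3_var u v t; rewrite /ev3 /Xt /var mevalXU.
have I3 (i : 'I_3) : [\/ i = inord 0, i = inord 1 | i = inord 2].
  by case: i => [[|[|[|i]]] ?] //; [constructor 1|constructor 2|constructor 3];
     apply: val_inj; rewrite /= inordK.
have d01 : s (inord 0) != s (inord 1).
  by rewrite (inj_eq perm_inj) -val_eqE /= !inordK.
have d02 : s (inord 0) != s (inord 2).
  by rewrite (inj_eq perm_inj) -val_eqE /= !inordK.
have d12 : s (inord 1) != s (inord 2).
  by rewrite (inj_eq perm_inj) -val_eqE /= !inordK.
pose H (q : {mpoly R[3]}) (c c' c'' : 'rV[R]_n) :=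
  ev3 (dotp c c') (dotp c c'') (dotp c' c'') q.
suff : T (H (msym s p)) = T (H p) by [].
move: (s (inord 0)) (s (inord 1)) (s (inord 2)) evs d01 d02 d12 => i j l.
(* Distinctness leaves six of the 27 cases; each is a word in the exchanges [T12] and [T23] of
   neighbouring points. *)
case: (I3 i) => ->; case: (I3 j) => ->; case: (I3 l) => ->;
  rewrite ?eqxx // => evs _ _ _.
- by apply: ext => c c' c''; rewrite /H evs pt0 pt1 pt2.
- rewrite T12; apply: ext => c c' c''.
  by rewrite /H evs pt0 pt1 pt2 (dotpC c').
- rewrite T23; apply: ext => c c' c''.
  by rewrite /H evs pt0 pt1 pt2 (dotpC c'').
- rewrite T23 T12; apply: ext => c c' c''.
  by rewrite /H evs pt0 pt1 pt2 !(dotpC _ c).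
- rewrite T12 T23; apply: ext => c c' c''.
  by rewrite /H evs pt0 pt1 pt2 !(dotpC c'').
- rewrite T12 T23 T12; apply: ext => c c' c''.
  by rewrite /H evs pt0 pt1 pt2 !(dotpC _ c) (dotpC c'').
Qed.
End Symmetrization.

Theorem corollary3p5 (R : realType) (n d k : nat)
    (hn : (3 <= n)%N) (hk : (k <= d)%N) :
  [/\ (Smx R n d k)^T = Smx R n d k,
      forall i j, Smx R n d k i j \is @mpoly.symmetric 3 R,
      forall (e : 'rV[R]_n) (C : {fset 'rV[R]_n}),
        unit_sphere e -> (forall c, c \in C -> unit_sphere c) ->
        psdmx (\sum_(c <- C) \sum_(c' <- C)
                 evmx (dotp e c) (dotp e c') (dotp c c') (Ymx R n d k))
    & forall C : {fset 'rV[R]_n},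
        (forall c, c \in C -> unit_sphere c) ->
        psdmx (\sum_(c <- C) \sum_(c' <- C) \sum_(c'' <- C)
                 evmx (dotp c c') (dotp c c'') (dotp c' c'') (Smx R n d k))].
Proof.
split; [exact: trmx_Smx|exact: Smx_symmetric|by move=> e C; exact: psdmx_Ymx|].
move=> C hC.
have -> : \sum_(c <- C) \sum_(c' <- C) \sum_(c'' <- C)
      evmx (dotp c c') (dotp c c'') (dotp c' c'') (Smx R n d k)
    = \sum_(c <- C) \sum_(c' <- C) \sum_(c'' <- C)
      evmx (dotp c c') (dotp c c'') (dotp c' c'') (Ymx R n d k).
  have sumE (M : 'M[{mpoly R[3]}]_((d - k).+1)) i j :
      (\sum_(c <- C) \sum_(c' <- C) \sum_(c'' <- C)
        evmx (dotp c c') (dotp c c'') (dotp c' c'') M) i j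
    = \sum_(c <- C) \sum_(c' <- C) \sum_(c'' <- C)
        ev3 (dotp c c') (dotp c c'') (dotp c' c'') (M i j).
    do 3!(rewrite summxE; apply: eq_bigr => ? _); by rewrite mxE.
  apply/matrixP => i j; rewrite !sumE [Smx _ _ _ _ i j]mxE.
  transitivity (6^-1 * \sum_(s : 'S_3) \sum_(c <- C) \sum_(c' <- C) \sum_(c'' <- C)
      ev3 (dotp c c') (dotp c c'') (dotp c' c'') (msym s (Ymx R n d k i j))).
    rewrite [X in _ * X]exchange_big mulr_sumr; apply: eq_bigr => c _ /=.
    rewrite [X in _ * X]exchange_big mulr_sumr; apply: eq_bigr => c' _ /=.
    rewrite [X in _ * X]exchange_big mulr_sumr; apply: eq_bigr => c'' _ /=.
    by rewrite /ev3 mevalZ raddf_sum.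
  (* The six permutations contribute equally, which cancels [6^-1]. *)
  under eq_bigr => s _ do rewrite sum_triples_msym.
  by rewrite sumr_const card_Sn -[X in _ * X]mulr_natl mulrA mulVf ?mul1r.
(* For fixed [c] the inner double sum is the case $e=c$ for $Y$. *)
by apply: psdmx_sum => c cC; apply: psdmx_Ymx => //; exact: hC.
Qed.
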